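(* Let $\mathbf T(C)$ be the tree defined in the context and let $(e_n)_{n\ge0}$ be the standard basis of $\ell^2$. Fix $m\ge1$ and let $(u_n)_{n=0}^{m-1}$ be an orthonormal set in $\ell^2$. Then $(u_n)_{n=0}^{m-1}\in\mathbf T(C)$ if and only if $(e_n)_{n=0}^{m-1}\in\mathbf T(C)$. In particular, every string $s\in\mathbf T(C)$ consisting entirely of orthonormal vectors satisfies $|s|\le 2^{C^2-2}$.
   Context: $\ell^2$ is the real Hilbert space of square-summable sequences. $2^{\mathbb N}$ is the Cantor space of infinite binary sequences and $C(2^{\mathbb N})$ is the Banach space of continuous real-valued functions on it with the supremum norm. Haar basis. Let $\mathcal O\subseteq 2^{<\mathbb N}$ consist of the empty string together with all finite binary strings ending in $0$. Enumerate $\mathcal O$ as $t_0,t_1,t_2,\ldots$ by increasing length and, among strings of equal length, lexicographically (at the first index where they differ, the string with entry $0$ comes first); thus $t_0=\varnothing$, $t_1=(0)$, $t_2=(00)$, $t_3=(10)$, $t_4=(000)$, $t_5=(010)$, $t_6=(100)$, $t_7=(110)$, etc. Let $V_n=\{\alpha\in 2^{\mathbb N}: t_n \text{ is an initial segment of }\alpha\}$ and $f_{t_n}=\chi_{V_n}\in C(2^{\mathbb N})$; $(f_{t_n})_{n\ge0}$ is the Haar basis of $C(2^{\mathbb N})$. For a real number $C\ge1$, $\mathbf T(C)=\mathbf T_{NU}(\ell^2,(f_{t_n}),C)$ is the tree of all finite sequences (strings) $(x_n)_{n=0}^{m-1}$ in $\ell^2$ such that for all real $a_0,\dots,a_{m-1}$,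 $$\tfrac1C\Big\|\sum_{n=0}^{m-1} a_nx_n\Big\|\le\Big\|\sum_{n=0}^{m-1} a_nf_{t_n}\Big\|_\infty\le C\Big\|\sum_{n=0}^{m-1} a_nx_n\Big\|.$$ $|s|$ denotes the length of a string $s$.
   Formalization: The bound |s| ≤ 2^{C²−2} is proved except for strings of length 1 when C² < 2; there the printed bound is false, since any single unit vector lies in T(C) while 2^{C²−2} < 1. *)

(* Defs.v *)
From HB Require Import structures.
From mathcomp Require Import all_boot all_order all_algebra ring lra.
From mathcomp Require Import all_classical all_reals all_analysis.

Set Implicit Arguments.
Unset Strict Implicit.
Unset Printing Implicit Defensive.
Import Order.TTheory GRing.Theory Num.Theory.
Import numFieldNormedType.Exports.

Local Open Scope classical_set_scope.
Local Open Scope ring_scope.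

Definition sqsummable (R : realType) (x : nat -> R) : Prop :=
  cvgn (series (fun n => x n ^+ 2)).

Definition sqsummable_pred (R : realType) : {pred nat -> R^o} :=
  fun x => `[< @sqsummable R x >].

Record ell2 (R : realType) := Ell2 {
  ell2_seq :> nat -> R^o;
  _ : ell2_seq \in @sqsummable_pred R }.

HB.instance Definition _ (R : realType) := [isSub for @ell2_seq R].
HB.instance Definition _ (R : realType) := [Choice of ell2 R by <:].

Section Ell2Lmodule.
Variable R : realType.
Implicit Types x y : nat -> R.

Lemma sqsummableP x : reflect (sqsummable x) (x \in @sqsummable_pred R).
Proof. exact: asboolP. Qed.

Lemma sqsummable_bound x (z : nat -> R) :
  (forall n, x n ^+ 2 <= z n) -> cvgn (series z) -> sqsummable x.
Proof.
move=> xz; apply: series_le_cvg => // n; first exact: sqr_ge0.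
by apply: le_trans (xz n); exact: sqr_ge0.
Qed.

Lemma is_cvg_seriesM x y : sqsummable x -> sqsummable y ->
  cvgn (series (fun n => x n * y n)).
Proof.
move=> cx cy; apply: normed_cvg.
have h n : `|x n * y n| <= x n ^+ 2 + y n ^+ 2.
  rewrite ler_norml; apply/andP; split.
    by have := sqr_ge0 (x n + y n); have := sqr_ge0 (x n);
      have := sqr_ge0 (y n); nra.
  by have := sqr_ge0 (x n - y n); have := sqr_ge0 (x n);
    have := sqr_ge0 (y n); nra.
apply: (@series_le_cvg R _
    ((fun n => x n ^+ 2 : R^o) + (fun n => y n ^+ 2 : R^o))) => [n|n|n|].
- exact: normr_ge0.
- exact: le_trans (normr_ge0 _) (h n).
- exact: h.
by rewrite seriesD; exact: is_cvgD.
Qed.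

Lemma sqsummable_submod_closed : submod_closed (@sqsummable_pred R).
Proof.
split=> [|a x y /sqsummableP cx /sqsummableP cy]; apply/sqsummableP.
  rewrite /sqsummable (_ : series _ = cst 0); first exact: is_cvg_cst.
  by apply/funext => n; rewrite /series/= big1// => i _; rewrite expr0n.
pose z := (2 * a ^+ 2) *: (fun n => x n ^+ 2 : R^o)
  + (2 : R) *: (fun n => y n ^+ 2 : R^o).
apply: (@sqsummable_bound _ z) => [n|].
  change ((a * x n + y n) ^+ 2 <= 2 * a ^+ 2 * x n ^+ 2 + 2 * y n ^+ 2).
  by have := sqr_ge0 (a * x n - y n); nra.
by rewrite seriesD !seriesZ; apply: is_cvgD; apply: is_cvgZr.
Qed.

HB.instance Definition _ := GRing.isSubmodClosed.Build _ _
  (@sqsummable_pred R) sqsummable_submod_closed.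
HB.instance Definition _ := [SubChoice_isSubLmodule of ell2 R by <:].

End Ell2Lmodule.

Section Ell2Norm.
Variable R : realType.
Implicit Types (x y z : ell2 R) (a : R).

Definition ell2_dot x y : R := limn (series (fun n => x n * y n)).

Lemma ell2P x : sqsummable x.
Proof. by apply/sqsummableP; exact: valP. Qed.

Lemma is_cvg_ell2_dot x y : cvgn (series (fun n => x n * y n)).
Proof. by apply: is_cvg_seriesM; exact: ell2P. Qed.

Lemma ell2_dotC x y : ell2_dot x y = ell2_dot y x.
Proof.
by rewrite /ell2_dot; congr (limn (series _)); apply/funext => n; rewrite mulrC.
Qed.

Lemma ell2_dotP a x y z :
  ell2_dot (a *: x + y) z = a * ell2_dot x z + ell2_dot y z.
Proof.
rewrite /ell2_dot.
have -> : (fun n => (a *: x + y : ell2 R) n * z n)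
    = a *: (fun n => x n * z n : R^o) + (fun n => y n * z n : R^o).
  apply/funext => n.
  by change ((a * x n + y n) * z n = a * (x n * z n) + y n * z n); ring.
rewrite seriesD seriesZ limD; last 2 first.
- by apply: is_cvgZr; exact: is_cvg_ell2_dot.
- exact: is_cvg_ell2_dot.
by rewrite limZr//; exact: is_cvg_ell2_dot.
Qed.

Lemma ell2_dotPr a x y z :
  ell2_dot z (a *: x + y) = a * ell2_dot z x + ell2_dot z y.
Proof. by rewrite ell2_dotC ell2_dotP !(ell2_dotC z). Qed.

Lemma ell2_dot_ge (n : nat) x : x n ^+ 2 <= ell2_dot x x.
Proof.
have nd : nondecreasing_seq (series (fun n => x n * x n)).
  by apply/nondecreasing_seqP => k; rewrite seriesSr lerDl -expr2 sqr_ge0.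
apply: le_trans (nondecreasing_cvgn_le nd (@is_cvg_ell2_dot x x) n.+1).
rewrite seriesSr expr2 lerDr /series/= sumr_ge0// => i _.
by rewrite -expr2 sqr_ge0.
Qed.

Lemma ell2_dot_ge0 x : 0 <= ell2_dot x x.
Proof. exact: le_trans (sqr_ge0 _) (ell2_dot_ge 0 x). Qed.

Lemma ell2_dot_eq0 x : ell2_dot x x = 0 -> x = 0.
Proof.
move=> x0; apply/val_inj/funext => n /=.
by apply/eqP; rewrite -sqrf_eq0 eq_le sqr_ge0 -x0 ell2_dot_ge.
Qed.

Lemma ell2_CauchySchwarz x y :
  ell2_dot x y ^+ 2 <= ell2_dot x x * ell2_dot y y.
Proof.
have [y0|y0] := eqVneq (ell2_dot y y) 0.
  rewrite y0 mulr0 (ell2_dot_eq0 y0).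
  have := ell2_dotPr (-1) 0 0 x.
  by rewrite scaler0 addr0 => h; rewrite (_ : ell2_dot x 0 = 0) ?expr0n//; lra.
have yy : 0 < ell2_dot y y by rewrite lt_neqAle eq_sym y0 ell2_dot_ge0.
have := ell2_dot_ge0 (- (ell2_dot x y / ell2_dot y y) *: y + x).
rewrite ell2_dotP !ell2_dotPr (ell2_dotC y x).
set A := ell2_dot x x; set B := ell2_dot y y; set D := ell2_dot x y.
move=> h; suff : 0 <= B * (A - D ^+ 2 / B).
  by rewrite mulrBr mulrCA mulfV// mulr1 subr_ge0 mulrC.
apply: mulr_ge0; first exact: ltW.
suff -> : A - D ^+ 2 / B = - (D / B) * (- (D / B) * B + D) + (- (D / B) * D + A).
  exact: h.
by field.
Qed.

Definition ell2_norm x : R := Num.sqrt (ell2_dot x x).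

Lemma ell2_norm_triangle x y : ell2_norm (x + y) <= ell2_norm x + ell2_norm y.
Proof.
rewrite -(@ler_pXn2r _ 2)// ?nnegrE ?addr_ge0 ?sqrtr_ge0//.
rewrite sqrrD !sqr_sqrtr ?ell2_dot_ge0//.
have := ell2_dotP 1 x y (x + y); rewrite scale1r mul1r => ->.
have := ell2_dotPr 1 x y x; rewrite scale1r mul1r => ->.
have := ell2_dotPr 1 x y y; rewrite scale1r mul1r => ->.
rewrite (ell2_dotC y x).
suff : ell2_dot x y <= ell2_norm x * ell2_norm y by rewrite mulr2n; lra.
rewrite -sqrtrM ?ell2_dot_ge0//; apply: le_trans (ler_norm _) _.
by rewrite -sqrtr_sqr ler_wsqrtr// ell2_CauchySchwarz.
Qed.

Lemma ell2_normZ a x : ell2_norm (a *: x) = `|a| * ell2_norm x.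
Proof.
rewrite /ell2_norm.
have dot0 z : ell2_dot 0 z = 0.
  by have := ell2_dotP (-1) 0 0 z; rewrite scaler0 addr0 => h; lra.
have := ell2_dotP a x 0 (a *: x); rewrite addr0 dot0 addr0 => ->.
have := ell2_dotPr a x 0 x; rewrite addr0 (ell2_dotC x 0) dot0 addr0 => ->.
by rewrite mulrA -expr2 sqrtrM ?sqr_ge0// sqrtr_sqr.
Qed.

Lemma ell2_norm_eq0 x : ell2_norm x = 0 -> x = 0.
Proof.
move/eqP; rewrite sqrtr_eq0 => h; apply: ell2_dot_eq0.
by apply/eqP; rewrite eq_le h ell2_dot_ge0.
Qed.

HB.instance Definition _ := Lmodule_isNormed.Build R (ell2 R)
  ell2_norm_triangle ell2_normZ ell2_norm_eq0.

End Ell2Norm.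

Lemma ell2_normE (R : realType) (x : ell2 R) : `|x| = Num.sqrt (ell2_dot x x).
Proof. by []. Qed.

Lemma sqsummable_stdbasis (R : realType) (n : nat) :
  (fun i => (i == n)%:R : R^o) \in @sqsummable_pred R.
Proof.
apply/sqsummableP/cvg_ex; exists (1 : R); apply: cvg_near_cst.
exists n.+1 => // k /= nk; rewrite /series/= big_mkord (bigD1 (Ordinal nk))//=.
rewrite eqxx expr1n big1 ?addr0// => i /negPf; rewrite -val_eqE/= => ->.
by rewrite expr0n.
Qed.

Definition stdbasis (R : realType) (n : nat) : ell2 R :=
  Ell2 (sqsummable_stdbasis R n).

Definition continuous_pred (R : realType) : {pred cantor_space -> R^o} :=
  fun f => `[< continuous f >].

Record Ccantor (R : realType) := CCantor {
  Ccantor_fun :> cantor_space -> R^o;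
  _ : Ccantor_fun \in @continuous_pred R }.

HB.instance Definition _ (R : realType) := [isSub for @Ccantor_fun R].
HB.instance Definition _ (R : realType) := [Choice of Ccantor R by <:].

Section CcantorLmodule.
Variable R : realType.

Lemma continuous_predP (f : cantor_space -> R^o) :
  reflect (continuous f) (f \in @continuous_pred R).
Proof. exact: asboolP. Qed.

Lemma continuous_submod_closed : submod_closed (@continuous_pred R).
Proof.
split=> [|a f g /continuous_predP cf /continuous_predP cg];
  apply/continuous_predP => t.
  exact: cvg_cst.
by apply: cvgD; [apply: cvgZr; exact: cf | exact: cg].
Qed.

HB.instance Definition _ := GRing.isSubmodClosed.Build _ _
  (@continuous_pred R) continuous_submod_closed.
HB.instance Definition _ := [SubChoice_isSubLmodule of Ccantor R by <:].

End CcantorLmodule.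

Section CcantorNorm.
Variable R : realType.
Implicit Types f g : Ccantor R.

Definition Ccantor_norm f : R := sup (range (fun t => `|f t|)).

Lemma CcantorP f : continuous f.
Proof. by apply/continuous_predP; exact: valP. Qed.

Lemma Ccantor_has_sup f : has_sup (range (fun t => `|f t|)).
Proof.
split; first by exists `|f point|; exists point.
have /compact_bounded [M [_ /(_ (M + 1))]] : compact (range f).
  apply: continuous_compact; last exact: cantor_space_compact.
  by apply: continuous_subspaceT; exact: CcantorP.
rewrite ltrDl => /(_ ltr01) h.
by exists (M + 1) => _ [t _ <-]; apply: h; exists t.
Qed.

Lemma Ccantor_norm_ge f t : `|f t| <= Ccantor_norm f.
Proof. by apply: ub_le_sup; [exact: (Ccantor_has_sup f).2 | exists t]. Qed.

Lemma Ccantor_norm_le f (c : R) : (forall t, `|f t| <= c) -> Ccantor_norm f <= c.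
Proof.
move=> fc; apply: ge_sup; first exact: (Ccantor_has_sup f).1.
by move=> _ [t _ <-].
Qed.

Lemma Ccantor_norm_triangle f g :
  Ccantor_norm (f + g) <= Ccantor_norm f + Ccantor_norm g.
Proof.
apply: Ccantor_norm_le => t; apply: le_trans (ler_normD (f t) (g t)) _.
by apply: lerD; exact: Ccantor_norm_ge.
Qed.

Lemma Ccantor_normZ (a : R) f : Ccantor_norm (a *: f) = `|a| * Ccantor_norm f.
Proof.
have le b h : Ccantor_norm (b *: h) <= `|b| * Ccantor_norm h.
  apply: Ccantor_norm_le => t.
  change (`|b * h t| <= `|b| * Ccantor_norm h).
  by rewrite normrM ler_wpM2l// Ccantor_norm_ge.
apply/eqP; rewrite eq_le le/=.
have [->|a0] := eqVneq a 0.
  rewrite normr0 mul0r; apply: le_trans (Ccantor_norm_ge _ point).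
  exact: normr_ge0.
have := le a^-1 (a *: f); rewrite scalerA mulVf// scale1r normfV.
by rewrite ler_pdivlMl// normr_gt0.
Qed.

Lemma Ccantor_norm_eq0 f : Ccantor_norm f = 0 -> f = 0.
Proof.
move=> f0; apply/val_inj/funext => t /=.
by apply/eqP; rewrite -normr_le0 -f0; exact: Ccantor_norm_ge.
Qed.

HB.instance Definition _ := Lmodule_isNormed.Build R (Ccantor R)
  Ccantor_norm_triangle Ccantor_normZ Ccantor_norm_eq0.

End CcantorNorm.

Lemma Ccantor_normE (R : realType) (f : Ccantor R) :
  `|f| = sup (range (fun t => `|f t|)).
Proof. by []. Qed.

(* The default value of [last] is false, so haarO contains the empty string. *)
Definition haarO : pred (seq bool) := fun t => ~~ last false t.

Fixpoint words (k : nat) : seq (seq bool) :=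
  if k is k'.+1 then [seq b :: w | b <- [:: false; true], w <- words k']
  else [:: [::]].

Definition haarO_upto (k : nat) : seq (seq bool) :=
  flatten [seq [seq t <- words i | haarO t] | i <- iota 0 k].

(* [words i] lists the strings of length i lexicographically. As haarO has a
   string of each length, its strings of length at most n include the first
   n.+1 ones. The lemmas haar_string_in, haar_string_onto and haar_string_lt
   say that haar_string enumerates haarO increasingly for the order slex. *)
Definition haar_string (n : nat) : seq bool := nth [::] (haarO_upto n.+1) n.

Definition slex (s t : seq bool) : bool :=
  (size s < size t)%N ||
  ((size s == size t) && ((s : seqlexi bool) < (t : seqlexi bool))%O).

Lemma haar_string8 : [seq haar_string n | n <- iota 0 8] =
  [:: [::]; [:: false]; [:: false; false]; [:: true; false];
      [:: false; false; false]; [:: false; true; false];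
      [:: true; false; false]; [:: true; true; false]].
Proof. by vm_compute. Qed.

Lemma mem_words k t : (t \in words k) = (size t == k).
Proof.
elim: k t => [|k IH] [|b t]//=.
  by apply/negbTE; rewrite cats0 mem_cat negb_or; apply/andP;
    split; apply/negP => /mapP[].
rewrite cats0 mem_cat eqSS -IH; apply/idP/idP => [|tk].
  by case/orP => /mapP[w wk [_ ->]].
by case: b; apply/orP; [right|left]; apply: map_f.
Qed.

Lemma mem_haarO_upto k t : (t \in haarO_upto k) = haarO t && (size t < k)%N.
Proof.
apply/flatten_mapP/andP => [[i]|[Ot tk]].
  by rewrite mem_iota mem_filter mem_words => /= ik /andP[-> /eqP->].
by exists (size t); rewrite ?mem_iota// mem_filter mem_words Ot eqxx.
Qed.

Lemma haarO_uptoS k :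
  haarO_upto k.+1 = haarO_upto k ++ [seq t <- words k | haarO t].
Proof. by rewrite /haarO_upto -addn1 iotaD map_cat flatten_cat/= cats0. Qed.

Lemma size_haarO_upto k : (k <= size (haarO_upto k))%N.
Proof.
elim: k => // k IH; rewrite haarO_uptoS size_cat -addn1 leq_add//.
have : nseq k false \in [seq t <- words k | haarO t].
  by rewrite mem_filter mem_words size_nseq eqxx andbT /haarO; elim: (k).
by case: [seq _ <- _ | _].
Qed.

Lemma haarO_upto_nth k n : (n < size (haarO_upto k))%N ->
  nth [::] (haarO_upto k) n = haar_string n.
Proof.
have catle i j m : (m < size (haarO_upto i))%N -> (i <= j)%N ->
    nth [::] (haarO_upto j) m = nth [::] (haarO_upto i) m.
  move=> mi /subnKC <-; elim: (j - i)%N => [|d IH]; first by rewrite addn0.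
  rewrite addnS haarO_uptoS nth_cat IH; case: ltnP => // h.
  exfalso; move: h; rewrite leqNgt => /negP; apply.
  apply: leq_trans mi _; elim: {IH}d => [|d IH]; first by rewrite addn0.
  by rewrite addnS haarO_uptoS size_cat (leq_trans IH)// leq_addr.
move=> nk; rewrite /haar_string; case: (leqP k n.+1) => h.
  by rewrite (catle k).
by rewrite (catle n.+1)// ?size_haarO_upto// ltnW.
Qed.

Lemma haar_string_in n : haarO (haar_string n).
Proof.
have : haar_string n \in haarO_upto n.+1.
  by rewrite /haar_string mem_nth// size_haarO_upto.
by rewrite mem_haarO_upto => /andP[].
Qed.

Lemma haar_string_onto t : haarO t -> exists n, haar_string n = t.
Proof.
move=> Ot; have tk : t \in haarO_upto (size t).+1.
  by rewrite mem_haarO_upto Ot ltnSn.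
exists (index t (haarO_upto (size t).+1)).
by rewrite -(@haarO_upto_nth (size t).+1) ?index_mem// nth_index.
Qed.

Lemma slex_trans : transitive slex.
Proof.
move=> y x z; rewrite /slex.
case/orP => [xy|/andP[/eqP xy lxy]]; case/orP => [yz|/andP[/eqP yz lyz]].
- by rewrite (ltn_trans xy yz).
- by rewrite -yz xy.
- by rewrite xy yz.
- by rewrite xy yz eqxx (lt_trans lxy lyz) orbT.
Qed.

Lemma sorted_words k : sorted slex (words k).
Proof.
elim: k => //= k IH; rewrite cats0 sorted_pairwise; last exact: slex_trans.
have cons b : pairwise slex [seq b :: w | w <- words k].
  rewrite -sorted_pairwise; last exact: slex_trans.
  rewrite sorted_map; apply: sub_sorted IH => x y.
  by rewrite /slex/= ltnS eqSS ltxi_cons lexx.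
rewrite pairwise_cat !cons !andbT; apply/allrelP => _ _ /mapP[x xk ->] /mapP[y yk ->].
rewrite /slex/= !eqSS ltxi_cons/=.
by move: xk yk; rewrite !mem_words => /eqP-> /eqP->; rewrite eqxx orbT.
Qed.

Lemma sorted_haarO_upto k : sorted slex (haarO_upto k).
Proof.
elim: k => // k IH; rewrite haarO_uptoS sorted_pairwise; last exact: slex_trans.
rewrite pairwise_cat -!sorted_pairwise ?IH//=; try exact: slex_trans.
rewrite sorted_filter ?sorted_words ?andbT//; last exact: slex_trans.
apply/allrelP => x y; rewrite mem_haarO_upto mem_filter mem_words.
by move=> /andP[_ xk] /andP[_ /eqP yk]; rewrite /slex yk xk.
Qed.

Lemma haar_string_lt m n : (m < n)%N -> slex (haar_string m) (haar_string n).
Proof.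
move=> mn; have nk := size_haarO_upto n.+1.
rewrite -(@haarO_upto_nth n.+1 m) ?(leq_trans _ nk) ?ltnS 1?ltnW//.
rewrite -(@haarO_upto_nth n.+1 n)//.
apply: (sorted_ltn_nth slex_trans) => //; first exact: sorted_haarO_upto.
by rewrite inE (leq_trans _ nk)// ltnS ltnW.
Qed.

Definition cyl (t : seq bool) : set cantor_space :=
  [set alpha | t = mkseq alpha (size t)].

Lemma cyl_continuous (R : realType) (t : seq bool) :
  (\1_(cyl t) : cantor_space -> R^o) \in @continuous_pred R.
Proof.
apply/continuous_predP => alpha; apply: cvg_near_cst.
have h k : \forall beta \near alpha, mkseq beta k = mkseq alpha k.
  elim: k => [|k IH]; first by apply: filterE.
  have : \forall beta \near alpha, beta k = alpha k.
    have := @proj_continuous nat (fun=> bool) k alpha.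
    move=> /(_ [set alpha k]) pc; apply: pc; exact: discrete_set1.
  by apply: filterS2 IH => beta; rewrite !mkseqS => -> ->.
apply: filterS (h (size t)) => beta hb; rewrite !indicE.
suff -> : (beta \in cyl t) = (alpha \in cyl t) by [].
apply/idP/idP => /set_mem tE; apply/mem_set; first exact: etrans tE hb.
exact: etrans tE (esym hb).
Qed.

Definition haar (R : realType) (n : nat) : Ccantor R :=
  CCantor (cyl_continuous R (haar_string n)).

Definition T_NU (R : realType) (V W : normedModType R) (f : nat -> W) (C : R) :
    set (seq V) :=
  [set x | forall a : 'I_(size x) -> R,
    C^-1 * `|\sum_(n < size x) a n *: x`_n| <=
      `|\sum_(n < size x) a n *: f n| <=
    C * `|\sum_(n < size x) a n *: x`_n|].

Definition ell2_orthonormal (R : realType) (x : seq (ell2 R)) : Prop :=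
  forall i j : 'I_(size x), ell2_dot x`_i x`_j = (i == j)%:R.

Definition haar_tree (R : realType) (C : R) : set (seq (ell2 R)) :=
  T_NU (haar R) C.

(* Main.v *)
Require Import Defs.
From HB Require Import structures.
From mathcomp Require Import all_boot all_order all_algebra.
From mathcomp Require Import all_classical all_reals all_analysis.
From mathcomp Require Import ring lra zify.

Set Implicit Arguments.
Unset Strict Implicit.
Unset Printing Implicit Defensive.
Import Order.TTheory GRing.Theory Num.Theory.
Import numFieldNormedType.Exports.
Local Open Scope classical_set_scope.
Local Open Scope ring_scope.

(** Orthonormal vectors satisfy [`|\sum a_n u_n| ^+ 2 = \sum a_n ^+ 2]
    ([norm_orthonormal_sum]), so membership of an orthonormal string in the
    tree only depends on its length ([haar_tree_orthonormal]); the standard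
    basis vectors are one such string.

    For the bound, it is enough to test the lower estimate of the tree on one
    combination of Haar functions.  Take a_0 = 1 and, for n >= 1,
    a_n = 2 (-1)^z with z the number of zeros of t_n.  Follow a point alpha of
    the Cantor space: the t_n that are initial segments of alpha are met in the
    order of their lengths, and each one after t_0 has exactly one more zero
    than the one before it, at its end.  So each of them flips the sign of the
    partial sum at alpha, whose successive values are 1, 1 - 2 = -1,
    -1 + 2 = 1, and so on ([haar_flip_sum]); hence the combination has norm at
    most 1 ([norm_haar_flip_sum]).  The sum of the squares of its first m
    coefficients is 4m - 3, hence 4m - 3 <= C^2.  For m >= 2 this gives
    m <= 2^(4m - 5) <= 2^(C^2 - 2), with much room; for m = 1 the bound
    2^(C^2 - 2) >= 1 amounts to C^2 >= 2, which is assumed in that case. *)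

Lemma ell2_dot0l (R : realType) (x : ell2 R) : ell2_dot 0 x = 0.
Proof.
by have := ell2_dotP (-1) 0 0 x; rewrite scaler0 addr0 => h; lra.
Qed.

Lemma ell2_dot_suml (R : realType) (m : nat) (a : 'I_m -> R)
    (x : 'I_m -> ell2 R) (y : ell2 R) :
  ell2_dot (\sum_n a n *: x n) y = \sum_n a n * ell2_dot (x n) y.
Proof.
elim/big_rec2: _ => [|n b z _ <-]; first exact: ell2_dot0l.
exact: ell2_dotP.
Qed.

Lemma norm_orthonormal_sum (R : realType) (x : seq (ell2 R))
    (a : 'I_(size x) -> R) : ell2_orthonormal x ->
  `|\sum_n a n *: x`_n| = Num.sqrt (\sum_n a n ^+ 2).
Proof.
move=> ox; rewrite ell2_normE ell2_dot_suml; congr Num.sqrt.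
apply: eq_bigr => i _; rewrite ell2_dotC ell2_dot_suml (bigD1 i)//= big1.
  by rewrite ox eqxx mulr1 addr0 expr2.
by move=> j /negPf ji; rewrite ox ji mulr0.
Qed.

Lemma haar_tree_orthonormal (R : realType) (C : R) (m : nat)
    (x : seq (ell2 R)) : size x = m -> ell2_orthonormal x ->
  haar_tree C x <-> forall a : 'I_m -> R,
    C^-1 * Num.sqrt (\sum_n a n ^+ 2) <= `|\sum_n a n *: haar R n| <=
    C * Num.sqrt (\sum_n a n ^+ 2).
Proof.
move=> <- ox; split=> h a; first by have := h a; rewrite norm_orthonormal_sum.
by rewrite norm_orthonormal_sum//; exact: h.
Qed.

Lemma ell2_dot_stdbasis (R : realType) (i j : nat) :
  ell2_dot (stdbasis R i) (stdbasis R j) = (i == j)%:R.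
Proof.
apply: cvg_lim => //; apply: cvg_near_cst; exists i.+1 => // k /= ik.
rewrite /series/= big_mkord (bigD1 (Ordinal ik))//= eqxx mul1r big1 ?addr0//.
by move=> n /negPf; rewrite -val_eqE/= => ->; rewrite mul0r.
Qed.

Lemma stdbasis_orthonormal (R : realType) (m : nat) :
  ell2_orthonormal (mkseq (stdbasis R) m).
Proof.
move=> i j; have sz := size_mkseq (stdbasis R) m.
by rewrite !nth_mkseq -?[X in (_ < X)%N]sz ?ltn_ord// ell2_dot_stdbasis.
Qed.

Lemma haar_string_size_lt (n m : nat) :
  (size (haar_string n) < size (haar_string m))%N -> (n < m)%N.
Proof.
move=> h; rewrite ltnNge leq_eqVlt; apply/negP => /orP[/eqP mn|/haar_string_lt].
  by rewrite mn ltnn in h.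
by rewrite /slex ltnNge (ltnW h)/= gtn_eqF.
Qed.

(** The enumeration increases in length, and two initial segments of the same
    point with equal lengths coincide. *)
Lemma haar_string_cyl_size_lt (n m : nat) (alpha : cantor_space) :
  (n < m)%N -> cyl (haar_string n) alpha -> cyl (haar_string m) alpha ->
  (size (haar_string n) < size (haar_string m))%N.
Proof.
move=> /haar_string_lt; rewrite /slex /cyl/=; case/orP => // /andP[/eqP snm].
by move=> + nE mE; rewrite {1}nE {1}mE snm ltxx.
Qed.

Lemma count_mkseq_nofalse (alpha : nat -> bool) (k l : nat) : (k <= l)%N ->
  (forall i, (k <= i < l)%N -> alpha i) ->
  count_mem false (mkseq alpha l) = count_mem false (mkseq alpha k).
Proof.
move=> /subnKC <-; elim: (l - k)%N => [|d IH] h; first by rewrite addn0.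
rewrite addnS mkseqS -cats1 count_cat /= h; last by lia.
by rewrite !addn0 IH// => i ?; apply: h; lia.
Qed.

(** The general formula would give 2 at n = 0; the coefficient 1 there makes
    the partial sums oscillate between 1 and -1 rather than between 2 and 0. *)
Definition haar_flip (R : realType) (n : nat) : R :=
  (if n == 0%N then 1 else 2) * (-1) ^+ count_mem false (haar_string n).

(** The string t_p is the last of t_0, ..., t_m that is an initial segment of
    alpha.  When alpha also lies in V_(m+1), only ones stand between the end of
    t_p and the final zero of t_(m+1), since a zero there would end a string of
    the enumeration lying strictly between t_p and t_(m+1).  So t_(m+1) has one
    more zero than t_p, and its term, twice the opposite of the partial sum,
    flips the sign. *)
Lemma haar_flip_sum (R : realType) (m : nat) (alpha : cantor_space) :
  exists p, [/\ (p <= m)%N, cyl (haar_string p) alpha,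
    forall n, (n <= m)%N -> cyl (haar_string n) alpha ->
      (size (haar_string n) <= size (haar_string p))%N &
    \sum_(n < m.+1) haar_flip R n * haar R n alpha =
      (-1) ^+ count_mem false (haar_string p)].
Proof.
have haarE n : haar R n alpha = \1_(cyl (haar_string n)) alpha by [].
elim: m => [|m [p [pm Vp pmax IH]]].
  exists 0%N; split => // [n|]; first by rewrite leqn0 => /eqP ->.
  rewrite big_ord_recl big_ord0 addr0 haarE indicE mem_set//.
  by rewrite /haar_flip/= !mul1r.
rewrite big_ord_recr IH haarE indicE/=.
have [Vm|nVm] := pselect (cyl (haar_string m.+1) alpha); last first.
  exists p; split=> // [|n|]; first exact: leqW.
    by rewrite leq_eqVlt => /predU1P[->//|]; rewrite ltnS; exact: pmax.
  by rewrite memNset// mulr0 addr0.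
have spm := haar_string_cyl_size_lt (pm : (p < m.+1)%N) Vp Vm.
exists m.+1; split=> // [n|].
  rewrite leq_eqVlt => /predU1P[->//|nm] Vn.
  exact/ltnW/haar_string_cyl_size_lt/Vm.
suff cE : count_mem false (haar_string m.+1) =
    (count_mem false (haar_string p)).+1.
  by rewrite mem_set// /haar_flip/= cE exprS; ring.
have := haar_string_in m.+1.
rewrite /cyl/= in Vp Vm; rewrite {1 2}Vm {1}Vp.
have lt n := @haar_string_size_lt n m.+1.
case: (size (haar_string m.+1)) spm lt => // l; rewrite ltnS => pl lt.
rewrite mkseqS /haarO last_rcons => /negPf al.
rewrite -cats1 count_cat/= al addn0 addn1; congr _.+1.
apply: count_mkseq_nofalse => // i /andP[pi il].
case ai : (alpha i) => //; exfalso.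
have [n nE] : exists n, haar_string n = mkseq alpha i.+1.
  by apply: haar_string_onto; rewrite /haarO mkseqS last_rcons ai.
have sn : size (haar_string n) = i.+1 by rewrite nE size_mkseq.
have nm : (n <= m)%N by rewrite -ltnS lt// sn ltnS.
have := pmax n nm; rewrite /cyl/= sn => /(_ nE); lia.
Qed.

Lemma Ccantor_sumE (R : realType) (m : nat) (f : 'I_m -> Ccantor R)
    (alpha : cantor_space) : (\sum_n f n : Ccantor R) alpha = \sum_n f n alpha.
Proof. exact: (big_morph (fun g : Ccantor R => g alpha)). Qed.

Lemma norm_haar_flip_sum (R : realType) (m : nat) :
  `|\sum_(n < m.+1) haar_flip R n *: haar R n| <= 1.
Proof.
apply: Ccantor_norm_le => alpha; rewrite Ccantor_sumE.
by have [p [_ _ _ /= ->]] := haar_flip_sum R m alpha; rewrite normrX normrN1 expr1n.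
Qed.

Lemma haar_flip_sumsq (R : realType) (m : nat) :
  \sum_(n < m.+1) haar_flip R n ^+ 2 = (4 * m + 1)%:R.
Proof.
elim: m => [|m IH].
  by rewrite big_ord_recl big_ord0 /haar_flip/= expr0 mulr1 expr1n addr0.
rewrite big_ord_recr IH /haar_flip/= exprMn sqrr_sign mulnS -addnA.
by rewrite (natrD _ 4) addrC; congr (_ + _); ring.
Qed.

Lemma haar_tree_orthonormal_size (R : realType) (C : R) (s : seq (ell2 R)) :
  1 <= C -> haar_tree C s -> ell2_orthonormal s ->
  4 * (size s)%:R - 3 <= C ^+ 2.
Proof.
move=> C1 Ts os; case sE : (size s) => [|m].
  by have := sqr_ge0 C; lra.
have /haar_tree_orthonormal := Ts; move=> /(_ _ sE os) /(_ (fun n => haar_flip R n)).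
case/andP => + _; rewrite haar_flip_sumsq => /le_trans/(_ (norm_haar_flip_sum R m)).
have C0 : 0 < C by lra.
rewrite ler_pdivrMl// mulr1 => h.
have := lerXn2r 2 (sqrtr_ge0 _ : _ \in Num.nneg) (ltW C0 : _ \in Num.nneg) h.
rewrite sqr_sqrtr ?ler0n//.
by rewrite natrD natrM -[m.+1]addn1 natrD; lra.
Qed.

Theorem corollary12 (R : realType) (C : R) (hC : 1 <= C) :
  (forall (m : nat) (u : m.-tuple (ell2 R)),
     (1 <= m)%N -> ell2_orthonormal u ->
     (haar_tree C u <-> haar_tree C (mkseq (stdbasis R) m))) /\
  (forall s : seq (ell2 R),
     haar_tree C s -> ell2_orthonormal s ->
     ~ (size s = 1%N /\ C ^+ 2 < 2) ->
     (size s)%:R <= 2 `^ (C ^+ 2 - 2)).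
Proof.
split=> [m u _ ou|s Ts os].
  rewrite (haar_tree_orthonormal C (size_tuple u) ou).
  by rewrite (haar_tree_orthonormal C (size_mkseq _ _) (@stdbasis_orthonormal R m)).
have := haar_tree_orthonormal_size hC Ts os.
case: (size s) => [|[|m]] mC n1; first exact: powR_ge0.
  have C2 : 2 <= C ^+ 2 by rewrite leNgt; apply/negP => ?; apply: n1.
  by rewrite -[leLHS](powRr0 2) ler_powR//; lra.
apply: (@le_trans _ _ (2 `^ (m.+2)%:R)).
  by rewrite powR_mulrn// -natrX ler_nat ltnW// ltn_expl.
by rewrite ler_powR ?ler1n//; move: mC; rewrite -[m.+2]addn2 natrD; have := ler0n R m; lra.
Qed.
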